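(* Let $K$ be an $(\mathbb{F}_q,\mathbb{Z})$-field and let $X\subseteq K^{k+r}$ be $\mathcal{L}_{\mathrm{aff}}^K$-definable. Let $\pi_k:K^{k+r}\to K^k$ be the projection onto the first $k$ coordinates. Then there exists an $\mathcal{L}_{\mathrm{aff}}^K$-definable function $g:\pi_k(X)\to X$ with $\pi_k\circ g=\mathrm{Id}_{\pi_k(X)}$.
   Context: An $(\mathbb{F}_q,\mathbb{Z})$-field is a valued field $K$ (valuation $\mathrm{ord}$, $\mathrm{ord}\,0=\infty$, valuation ring $R_K$; not necessarily Henselian, any characteristic) whose residue field is isomorphic to $\mathbb{F}_q$ and whose value group is elementarily equivalent to $\mathbb{Z}$. Fix $\pi\in K$ of smallest positive order, $\mathrm{ord}\,\pi=1$. For $m\ge1$, $\mathrm{ac}_{\pi^m}:K^\times\to(R_K/\pi^mR_K)^\times$ is the unique group homomorphism with $\mathrm{ac}_{\pi^m}(\pi)=1$ and $\mathrm{ac}_{\pi^m}(u)\equiv u\bmod\pi^m$ for units $u$. For $n,m\ge1$, $\Lambda_{n,m}$ is the quotient of $K$ by: $x\sim y$ iff $x=y=0$, or $x,y\ne0$, $\mathrm{ord}\,x\equiv\mathrm{ord}\,y\bmod n$ and $\mathrm{ac}_{\pi^m}(x)=\mathrm{ac}_{\pi^m}(y)$; $\rho_{n,m}:K\to\Lambda_{n,m}$ is the quotient map. The one-sorted language $\mathcal{L}_{\mathrm{aff}}^K$ consists of $+,-$, scalar multiplications $\bar c:x\mapsto cx$ for all $c\in K$, the relation $x\mid y\iff\mathrm{ord}\,x\le\mathrm{ord}\,y$,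 and ternary relations $R_{n,m}(x,y,z)\iff\rho_{n,m}(y-x)=\rho_{n,m}(z)$ ($n,m\ge1$); parameters from $K$ are allowed. *)

(* Defs.v *)
From HB Require Import structures.
From mathcomp Require Import all_boot all_order all_algebra.
Set Implicit Arguments. Unset Strict Implicit. Unset Printing Implicit Defensive.
Import Order.TTheory GRing.Theory Num.Theory.
Local Open Scope ring_scope.

(* A Z-group (model of Presburger arithmetic): a totally ordered abelian
   group (G,+,<=), discretely ordered with a least positive element e, such
   that G/nG has the n classes e*0, ..., e*(n-1) for every n >= 1.  These are
   exactly the ordered abelian groups elementarily equivalent to Z. *)
Definition ZGroup (G : zmodType) (le : rel G) : Prop :=
  [/\ (forall x, le x x) /\
      (forall x y z, le x y -> le y z -> le x z),
      (forall x y, le x y -> le y x -> x = y),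
      (forall x y, le x y \/ le y x),
      (forall x y z, le x y -> le (x + z) (y + z))
    & exists e : G,
      [/\ le 0 e, e <> 0,
          (forall x, le 0 x -> x <> 0 -> le e x)
        & (forall n : nat, (0 < n)%N -> forall x : G,
             exists (y : G) (i : nat), (i < n)%N /\ x = y *+ n + e *+ i)]].

(* ---------- values with infinity (None = +oo) ---------- *)
Definition ole (G : zmodType) (le : rel G) (a b : option G) : bool :=
  match a, b with
  | _, None => true
  | None, Some _ => false
  | Some a, Some b => le a b
  end.

Definition oadd (G : zmodType) (a b : option G) : option G :=
  match a, b with
  | Some a, Some b => Some (a + b)
  | _, _ => None
  end.

Section FqZ.
Variables (K : fieldType) (G : zmodType) (le : rel G) (ord : K -> option G).

Definition is_valuation : Prop :=
  [/\ (forall x, ord x = None <-> x = 0),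
      (forall x y, ord (x * y) = oadd (ord x) (ord y)),
      (forall x y, ole le (ord x) (ord (x + y)) || ole le (ord y) (ord (x + y)))
    & (forall g : G, exists x : K, ord x = Some g)].

Definition in_RK (x : K) : bool := ole le (Some 0) (ord x).

(* The residue field R_K / m_K is isomorphic to the field with q elements:
   there is a surjective ring morphism from R_K onto a finite field with q
   elements whose kernel is the maximal ideal m_K. *)
Definition residue_field_Fq (q : nat) : Prop :=
  exists (F : finFieldType) (res : K -> F),
    [/\ #|F| = q /\
        res 1 = 1,
        (forall x y, in_RK x -> in_RK y -> res (x + y) = res x + res y),
        (forall x y, in_RK x -> in_RK y -> res (x * y) = res x * res y),
        (forall a : F, exists x, in_RK x /\ res x = a)
      & (forall x, in_RK x -> (res x = 0 <-> ~~ ole le (ord x) (Some 0)))].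

Definition FqZField (q : nat) : Prop :=
  [/\ ZGroup le, is_valuation & residue_field_Fq q].

Definition uniformizer (pi : K) : Prop :=
  exists e : G, [/\ ord pi = Some e, le 0 e, e <> 0 &
                    forall g, le 0 g -> g <> 0 -> le e g].

Variable pi : K.

Definition congr_pim (m : nat) (a b : K) : bool :=
  ole le (ord (pi ^+ m)) (ord (a - b)).

(* ac : K -> K is (a choice of representatives in R_K^x of) a group
   homomorphism K^x -> (R_K/pi^m R_K)^x with ac(pi) = 1 and ac(u) = u mod pi^m
   for units u.  Such a homomorphism is unique (as a map to the quotient). *)
Definition ac_spec (m : nat) (ac : K -> K) : Prop :=
  [/\ (forall x, x != 0 -> ord (ac x) = Some 0),
      (forall x y, x != 0 -> y != 0 -> congr_pim m (ac (x * y)) (ac x * ac y)),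
      congr_pim m (ac pi) 1
    & (forall u, ord u = Some 0 -> congr_pim m (ac u) u)].

Definition rho_eq (n m : nat) (x y : K) : Prop :=
  (x = 0 /\ y = 0) \/
  [/\ x != 0, y != 0,
      (exists (a b z : G), [/\ ord x = Some a, ord y = Some b & a - b = z *+ n])
    & (forall ac, ac_spec m ac -> congr_pim m (ac x) (ac y))].

Inductive term : Type :=
  | TVar of nat
  | TConst of K
  | TAdd of term & term
  | TSub of term & term
  | TScal of K & term.

Inductive formula : Type :=
  | FEq of term & term
  | FDiv of term & term
  | FR of nat & nat & term & term & term (* FR n m : R_{n+1,m+1} *)
  | FNot of formula
  | FAnd of formula & formula
  | FOr of formula & formula
  | FEx of nat & formula
  | FAll of nat & formula.

Fixpoint teval (e : nat -> K) (t : term) : K :=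
  match t with
  | TVar i => e i
  | TConst c => c
  | TAdd t1 t2 => teval e t1 + teval e t2
  | TSub t1 t2 => teval e t1 - teval e t2
  | TScal c t1 => c * teval e t1
  end.

Definition upd (e : nat -> K) (i : nat) (a : K) : nat -> K :=
  fun j => if j == i then a else e j.

Fixpoint sat (e : nat -> K) (f : formula) : Prop :=
  match f with
  | FEq t1 t2 => teval e t1 = teval e t2
  | FDiv t1 t2 => ole le (ord (teval e t1)) (ord (teval e t2))
  | FR n m t1 t2 t3 => rho_eq n.+1 m.+1 (teval e t2 - teval e t1) (teval e t3)
  | FNot f1 => ~ sat e f1
  | FAnd f1 f2 => sat e f1 /\ sat e f2
  | FOr f1 f2 => sat e f1 \/ sat e f2
  | FEx i f1 => exists a : K, sat (upd e i a) f1
  | FAll i f1 => forall a : K, sat (upd e i a) f1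
  end.

Definition tenv (n : nat) (x : n.-tuple K) : nat -> K :=
  fun i => nth 0 x i.

Definition definable (n : nat) (X : n.-tuple K -> Prop) : Prop :=
  exists f : formula, forall x : n.-tuple K, X x <-> sat (tenv x) f.

End FqZ.

Definition proj_k (T : Type) (k r : nat) (x : (k + r).-tuple T) : k.-tuple T :=
  [tuple tnth x (lshift r i) | i < k].

Definition fst_part (T : Type) (a b : nat) (z : (a + b).-tuple T) : a.-tuple T :=
  [tuple tnth z (lshift b i) | i < a].
Definition snd_part (T : Type) (a b : nat) (z : (a + b).-tuple T) : b.-tuple T :=
  [tuple tnth z (rshift a i) | i < b].

Definition proj_set (T : Type) (k r : nat) (X : (k + r).-tuple T -> Prop)
  (y : k.-tuple T) : Prop := exists x, X x /\ proj_k x = y.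

Definition graph_on (T : Type) (k r : nat) (X : (k + r).-tuple T -> Prop)
  (g : k.-tuple T -> (k + r).-tuple T) (z : (k + (k + r)).-tuple T) : Prop :=
  proj_set X (fst_part z) /\ snd_part z = g (fst_part z).

(* Main.v *)
Require Import Defs.
From HB Require Import structures.
From mathcomp Require Import all_boot all_order all_algebra.
From mathcomp Require Import ring finfield.
From Stdlib Require Import Classical ClassicalEpsilon.
From Stdlib Require List.

(** The language has definable Skolem functions that are piecewise terms, by a
    test-point argument. All atoms only involve forms [a x + s] with [a]
    a constant and [s] an affine term in the other variables, that is, orders
    and classes of [x - c_j] for finitely many affine centres [c_j]. Let [c] be
    the centre nearest to [x]. By the ultrametric inequality these data are
    determined by the class of [u = x - c] modulo a finite-index subgroup
    [(K^x)^E (1 + pi^M R_K)] and by the position of [ord u] among the orders of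
    finitely many affine terms [d]. Since the residue field is finite and the
    value group is a Z-group, the same class and position are realised by
    some [kappa * d] with [kappa] in a finite set of constants. Hence finitely
    many affine terms [c + kappa * d] suffice as witnesses for an existential
    quantifier; this gives quantifier elimination and, iterating, finitely many
    tuples of terms among which the first one that works is a definable
    choice. *)

Set Implicit Arguments.
Unset Strict Implicit.
Unset Printing Implicit Defensive.

Section ValuedField.

Import GRing.Theory.
Local Open Scope ring_scope.

Variables (K : fieldType) (G : zmodType) (le : rel G) (ord : K -> option G).
Variables (q : nat) (HK : FqZField le ord q).
Variables (pi : K) (Hpi : uniformizer le ord pi).

(** * Orders compared directly on elements of [K] *)

Definition vle (x y : K) : bool := ole le (ord x) (ord y).

Let valued : is_valuation le ord.
Proof. by case: HK. Qed.

Let zgroup : ZGroup le.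
Proof. by case: HK. Qed.

Let ordM x y : ord (x * y) = oadd (ord x) (ord y).
Proof. by case: valued => _ + _ _; apply. Qed.

Let le_refl x : le x x.
Proof. by case: zgroup => -[H _] *; apply: H. Qed.

Let le_trans x y z : le x y -> le y z -> le x z.
Proof. by case: zgroup => -[_ H] *; apply: (H x y z). Qed.

Let le_anti x y : le x y -> le y x -> x = y.
Proof. by case: zgroup => _ H *; apply: H. Qed.

Let le_total x y : le x y \/ le y x.
Proof. by case: zgroup => _ _ H *; apply: H. Qed.

Let le_add z x y : le x y -> le (x + z) (y + z).
Proof. by case: zgroup => _ _ _ H *; apply: H. Qed.

Let le_addE z x y : le (x + z) (y + z) = le x y.
Proof.
apply/idP/idP; last exact: le_add.
by move/(le_add (- z)); rewrite !addrK.
Qed.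

Lemma ord_zero : ord 0 = None.
Proof. by case: valued => /(_ 0)[_ H] *; apply: H. Qed.

Lemma ord_neq0 x : x != 0 -> exists g, ord x = Some g.
Proof.
case E : (ord x) => [g|]; first by exists g.
by case: valued => /(_ x)[/(_ E) ->]; rewrite eqxx.
Qed.

Lemma ord_Some_neq0 x g : ord x = Some g -> x != 0.
Proof. by move=> Ex; apply/eqP=> x0; rewrite x0 ord_zero in Ex. Qed.

Lemma ord_one : ord 1 = Some 0.
Proof.
have [g Eg] := ord_neq0 (oner_neq0 K).
have := ordM 1 1; rewrite mulr1 Eg /= => -[H].
by congr Some; apply: (addrI g); rewrite -H addr0.
Qed.

Lemma ordX x g n : ord x = Some g -> ord (x ^+ n) = Some (g *+ n).
Proof.
move=> Ex; elim: n => [|n IH]; first by rewrite expr0 ord_one.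
by rewrite exprS ordM Ex IH /= mulrS.
Qed.

Lemma vlexx x : vle x x.
Proof. by rewrite /vle; case: (ord x) => //=. Qed.

Lemma vle_trans y x z : vle x y -> vle y z -> vle x z.
Proof.
rewrite /vle; case: (ord x) (ord y) (ord z) => [a|] [b|] [c|] //=.
exact: le_trans.
Qed.

Lemma vle_total x y : vle x y || vle y x.
Proof.
rewrite /vle; case: (ord x) (ord y) => [a|] [b|] //=.
by apply/orP; apply: le_total.
Qed.

Lemma vleNge x y : ~~ vle x y -> vle y x.
Proof. by move=> /negPf nxy; have := vle_total x y; rewrite nxy. Qed.

Lemma vle0r x : vle x 0.
Proof. by rewrite /vle ord_zero; case: (ord x). Qed.

Lemma vle0l x : vle 0 x = (x == 0).
Proof.
have [->|nx] := eqVneq x 0; first exact: vle0r.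
by rewrite /vle ord_zero; have [g ->] := ord_neq0 nx.
Qed.

Lemma vle_pmul2l c x y : c != 0 -> vle (c * x) (c * y) = vle x y.
Proof.
move=> /ord_neq0[g Eg]; rewrite /vle !ordM Eg.
by case: (ord x) (ord y) => [a|] [b|] //=; rewrite ![g + _]addrC le_addE.
Qed.

Lemma vle_mul2l c x y : vle x y -> vle (c * x) (c * y).
Proof.
have [->|nc] := eqVneq c 0; first by rewrite !mul0r vlexx.
by rewrite vle_pmul2l.
Qed.

Lemma vle_mul x y z t : vle x y -> vle z t -> vle (x * z) (y * t).
Proof.
move=> xy zt; apply: (@vle_trans (x * t)); first exact: vle_mul2l.
by rewrite ![_ * t]mulrC; apply: vle_mul2l.
Qed.

(* [vle 1 (-1)] and [vle (-1) 1] are exchanged by multiplication by [-1]. *)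
Lemma vle_opp z x : vle z x -> vle z (- x).
Proof.
have H : vle 1 (-1).
  have /orP[//|h] := vle_total 1 (-1).
  by have := vle_mul2l (-1) h; rewrite mulr1 mulrNN mulr1.
by move=> zx; have := vle_mul zx H; rewrite mulr1 mulrN1.
Qed.

Lemma vle_add z x y : vle z x -> vle z y -> vle z (x + y).
Proof.
move=> zx zy; case: valued => _ _ /(_ x y)/orP[] h _.
  exact: vle_trans zx h.
exact: vle_trans zy h.
Qed.

Lemma vle_sub z x y : vle z x -> vle z y -> vle z (x - y).
Proof. by move=> zx zy; apply: vle_add => //; apply: vle_opp. Qed.

Lemma vle_sum z (I : Type) (r : seq I) (P : pred I) (F : I -> K) :
  (forall i, P i -> vle z (F i)) -> vle z (\sum_(i <- r | P i) F i).
Proof.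
move=> zF; apply: (big_ind (fun t => is_true (vle z t))) => //.
  exact: vle0r.
exact: vle_add.
Qed.

Lemma vle_exp1 x n : vle 1 x -> vle 1 (x ^+ n).
Proof.
move=> x1; elim: n => [|n IH]; first by rewrite expr0 vlexx.
by rewrite exprS -[1]mulr1; apply: vle_mul.
Qed.

Lemma pi_neq0 : pi != 0.
Proof. by case: Hpi => e [/ord_Some_neq0]. Qed.

Lemma piX_neq0 n : pi ^+ n != 0.
Proof. by rewrite expf_neq0 ?pi_neq0. Qed.

Lemma vle1pi : vle 1 pi.
Proof. by case: Hpi => e [Ee e0 _ _]; rewrite /vle ord_one Ee. Qed.

Lemma vlepi1 : ~~ vle pi 1.
Proof.
case: Hpi => e [Ee e0 e1 _]; rewrite /vle ord_one Ee /=.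
by apply/negP=> h; case: e1; apply: le_anti.
Qed.

(** Discreteness of the value group: a positive difference of orders is at least [ord pi]. *)
Lemma vlt_pi x y : ~~ vle y x -> vle (pi * x) y.
Proof.
have [->|nx] := eqVneq x 0; first by rewrite vle0r.
have [->|ny] := eqVneq y 0; first by rewrite vle0r.
have [[a Ea] [b Eb]] := (ord_neq0 nx, ord_neq0 ny).
case: Hpi => e [Ee _ _ emin]; rewrite /vle ordM Ea Eb Ee /= => nba.
have ab : le a b by have [//|h] := le_total a b; rewrite h in nba.
rewrite -[b](subrK a) le_addE; apply: emin.
  by rewrite -(subrr a) le_addE.
by move=> /subr0_eq H; rewrite H le_refl in nba.
Qed.

Lemma vle_piX n : vle 1 (pi ^+ n).
Proof. exact: vle_exp1 vle1pi. Qed.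

Lemma vle_piX2 m n : (m <= n)%N -> vle (pi ^+ m) (pi ^+ n).
Proof.
move=> mn; rewrite -(subnKC mn) exprD -{1}[pi ^+ m]mulr1.
by apply: vle_mul2l; apply: vle_piX.
Qed.

(** * Equality of orders *)

Definition veq (x y : K) : bool := vle x y && vle y x.

Lemma veqxx x : veq x x.
Proof. by rewrite /veq vlexx. Qed.

Lemma veq_sym x y : veq x y = veq y x.
Proof. by rewrite /veq andbC. Qed.

Lemma veq_trans y x z : veq x y -> veq y z -> veq x z.
Proof.
move=> /andP[xy yx] /andP[yz zy].
by rewrite /veq (vle_trans xy yz) (vle_trans zy yx).
Qed.

Lemma veq_vle x x' y y' : veq x x' -> veq y y' -> vle x y = vle x' y'.
Proof.
move=> /andP[xx' x'x] /andP[yy' y'y]; apply/idP/idP => h.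
  exact: vle_trans x'x (vle_trans h yy').
exact: vle_trans xx' (vle_trans h y'y).
Qed.

Lemma veq_mul x x' y y' : veq x x' -> veq y y' -> veq (x * y) (x' * y').
Proof.
by move=> /andP[a b] /andP[c d]; rewrite /veq !vle_mul.
Qed.

Lemma veq_neq0 x y : veq x y -> (x == 0) = (y == 0).
Proof. by move=> xy; rewrite -!vle0l; apply: veq_vle; rewrite ?veqxx. Qed.

Lemma veq_mulVl c x : c != 0 -> veq x c -> veq (c^-1 * x) 1.
Proof.
by move=> nc xc; rewrite -(mulVf nc); apply: veq_mul => //; apply: veqxx.
Qed.

Lemma veq_ord x g : ord x = Some g -> g = 0 <-> veq x 1.
Proof.
move=> Ex; rewrite /veq /vle Ex ord_one /=; split=> [->|/andP[h1 h2]].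
  by rewrite le_refl.
exact: le_anti.
Qed.

Lemma veq_same_ord x y : ord x = ord y -> veq x y.
Proof. by move=> E; rewrite /veq /vle E; move: (vlexx y); rewrite /vle => ->. Qed.

(** By discreteness, climbing from [w] in steps of [ord pi] cannot jump over the order of [u]. *)
Lemma pi_interval n w u : vle w u -> ~~ vle (pi ^+ n * w) u ->
  exists2 j, (j < n)%N & veq u (pi ^+ j * w).
Proof.
move=> wu; elim: n => [|n IH]; first by rewrite expr0 mul1r wu.
move=> nu; have [h|h] := boolP (vle (pi ^+ n * w) u).
  exists n => //; rewrite /veq h andbT.
  by apply/negPn/negP => /vlt_pi; rewrite mulrA -exprS (negPf nu).
by have [j jn ?] := IH h; exists j => //; apply: leqW.
Qed.

(** * The groups 1 + pi^M R_K, residue rings and exponents of unit groups *)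

Definition cong1 M v := vle (pi ^+ M) (v - 1).

(** If [pi] divided both v - 1 and v, it would divide 1. *)
Lemma cong1_unit M v : (0 < M)%N -> cong1 M v -> veq v 1.
Proof.
move=> M0 h; have h1 : vle pi (v - 1).
  by apply: vle_trans h; rewrite -{1}[pi]expr1 vle_piX2.
have h2 : vle 1 v.
  rewrite -[v](subrK 1); apply: vle_add; last exact: vlexx.
  exact: vle_trans vle1pi h1.
rewrite /veq h2 andbT; apply/negPn/negP => /vlt_pi; rewrite mulr1 => h3.
move/negP: vlepi1; apply; have -> : 1 = v - (v - 1) by ring.
exact: vle_sub.
Qed.

Lemma cong1_1 M : cong1 M 1.
Proof. by rewrite /cong1 subrr vle0r. Qed.

Lemma cong1M M v w : cong1 M v -> cong1 M w -> cong1 M (v * w).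
Proof.
move=> hv hw; rewrite /cong1.
have -> : v * w - 1 = (v - 1) * (w - 1) + ((v - 1) + (w - 1)) by ring.
apply: vle_add; last exact: vle_add.
rewrite -{1}[pi ^+ M]mulr1; apply: vle_mul => //.
exact: vle_trans (vle_piX _) hw.
Qed.

Lemma cong1V M v : (0 < M)%N -> cong1 M v -> cong1 M v^-1.
Proof.
move=> M0 hv; have v1 := cong1_unit M0 hv; have [v1' _] := andP v1.
have nv : v != 0 by rewrite (veq_neq0 v1) oner_neq0.
rewrite /cong1 -(vle_pmul2l _ _ nv) mulrBr mulfV // mulr1.
have -> : 1 - v = - (v - 1) by ring.
apply: vle_opp; apply: vle_trans hv; rewrite -{2}[pi ^+ M]mul1r.
by apply: vle_mul => //; apply: vlexx.
Qed.

Lemma cong1X M v n : cong1 M v -> cong1 M (v ^+ n).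
Proof.
move=> hv; elim: n => [|n IH]; first by rewrite expr0 cong1_1.
by rewrite exprS; apply: cong1M.
Qed.

Lemma cong1W m M v : (m <= M)%N -> cong1 M v -> cong1 m v.
Proof. by move=> mM; apply: vle_trans; apply: vle_piX2. Qed.

(** One preimage under [res] is chosen for each of the finitely many residues. Elements with equal
    residue differ by an element of positive order, which [pi] divides by discreteness. *)
Lemma residue_reps : exists S : seq K,
  forall x, vle 1 x -> exists2 s, List.In s S & vle pi (x - s).
Proof.
case: HK => _ _ [F [res [_ resD _ res_surj res0]]].
have RE x : in_RK le ord x = vle 1 x by rewrite /in_RK /vle ord_one.
have [f Hf] := fin_all_exists res_surj.
exists (List.map f (enum F)) => x x1.
have [] := Hf (res x); rewrite RE => fx1 Efx; exists (f (res x)).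
  apply: List.in_map; have : res x \in enum F by rewrite mem_enum.
  elim: (enum F) => // a s IH; rewrite inE => /predU1P[->|/IH]; first by left.
  by right.
have d1 : vle 1 (x - f (res x)) by apply: vle_sub.
have Ed : res (x - f (res x)) = 0.
  have := resD _ _ (etrans (RE _) d1) (etrans (RE _) fx1).
  by rewrite subrK Efx => H; apply: (addIr (res x)); rewrite -H add0r.
have [/(_ Ed) nd _] := res0 _ (etrans (RE _) d1).
rewrite -ord_one in nd; have := @vlt_pi 1 (x - f (res x)) nd.
by rewrite mulr1.
Qed.

(** Induction on pi-adic digits: the next digit represents (x - s) / pi^M modulo pi. *)
Lemma residue_reps_pow M : exists S : seq K,
  forall x, vle 1 x -> exists2 s, List.In s S & vle (pi ^+ M) (x - s).
Proof.
have [S1 HS1] := residue_reps.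
elim: M => [|M [S HS]].
  exists [:: 0] => x x1; exists 0; first by left.
  by rewrite subr0 expr0.
exists (List.flat_map (fun s => List.map (fun t => s + pi ^+ M * t) S1) S).
move=> x x1; have [s Ss xs] := HS _ x1.
set y := (pi ^+ M)^-1 * (x - s).
have Ey : x - s = pi ^+ M * y by rewrite /y mulVKf ?piX_neq0.
have [|t St yt] := HS1 y.
  by rewrite -(vle_pmul2l _ _ (piX_neq0 M)) mulr1 -Ey.
exists (s + pi ^+ M * t).
  apply/List.in_flat_map; exists s; split=> //.
  by apply: (List.in_map (fun t => s + pi ^+ M * t)).
have -> : x - (s + pi ^+ M * t) = pi ^+ M * (y - t) by rewrite mulrBr -Ey; ring.
by rewrite exprSr; apply: vle_mul2l.
Qed.

(* The residue field gives an exponent killing units modulo pi; raising to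
   the residue characteristic p then gains one power of pi at a time, since
   v^p - 1 = (v - 1) (1 + v + ... + v^(p-1)) and the second factor is
   congruent to p. *)
Lemma unit_exponent M : exists2 E, (0 < E)%N &
  forall w, veq w 1 -> cong1 M (w ^+ E).
Proof.
case: HK => _ _ [F [res [[_ res1] resD resM _ res0]]].
have RE x : in_RK le ord x = vle 1 x by rewrite /in_RK /vle ord_one.
have piP x : vle 1 x -> res x = 0 <-> vle pi x.
  move=> x1; rewrite res0 ?RE // -ord_one; split=> h.
    by have := @vlt_pi 1 x h; rewrite mulr1.
  by apply/negP=> h2; move/negP: vlepi1; apply; apply: vle_trans h h2.
have resX x n : vle 1 x -> res (x ^+ n) = res x ^+ n.
  move=> x1; elim: n => [|n IH]; first by rewrite !expr0.
  by rewrite !exprS resM ?RE ?IH // vle_exp1.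
have v11 := vlexx 1.
have resN1 x : vle 1 x -> res (x - 1) = res x - 1.
  move=> x1; apply: (addIr 1); rewrite subrK -res1 -resD ?RE ?vle_sub //.
  by rewrite subrK.
have [p pr_p /andP[_ /eqP p0]] := finPcharP F.
have resn n : vle 1 n%:R /\ res n%:R = n%:R.
  elim: n => [|n [h IH]].
    split; first exact: vle0r.
    by apply/piP; rewrite vle0r.
  by rewrite !mulrSr vle_add // resD ?RE // IH res1.
have step k v : (0 < k)%N -> cong1 k v -> cong1 k.+1 (v ^+ p).
  move=> k0 hv; rewrite /cong1 subrX1 exprSr; apply: vle_mul => //.
  have /andP[_ v1] := cong1_unit k0 hv.
  have -> : \sum_(i < p) v ^+ i = \sum_(i < p) (v ^+ i - 1) + p%:R.
    by rewrite sumrB sumr_const card_ord subrK.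
  apply: vle_add; last by apply/piP; rewrite ?(proj1 (resn p)) // (proj2 (resn p)).
  apply: vle_sum => i _; rewrite -{1}[pi]expr1.
  by apply: (cong1W k0); apply: cong1X.
exists (#|F|.-1 * p ^ M)%N.
  rewrite muln_gt0 expn_gt0 (prime_gt0 pr_p) andbT -ltnS prednK ?finNzRing_gt1 //.
  exact: ltnW (finNzRing_gt1 F).
move=> w w1; have /andP[_ w1'] := w1.
(* Aiming at precision M + 1 lets the induction start modulo pi, since [step] needs a positive
   precision. *)
suff H : cong1 M.+1 (w ^+ (#|F|.-1 * p ^ M)) by apply: cong1W H.
elim: M => [|M IH]; last by rewrite expnSr mulnA exprM; apply: step.
rewrite expn0 muln1 /cong1 expr1; apply/piP; first by rewrite vle_sub // vle_exp1.
rewrite resN1 ?vle_exp1 // resX //; apply/eqP; rewrite subr_eq0; apply/eqP.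
have rw : res w != 0.
  apply/eqP=> /piP; rewrite w1' => /(_ isT) h; move/negP: vlepi1; apply.
  by case/andP: w1 => w1 _; apply: vle_trans h w1.
apply: (mulIf rw); rewrite mul1r -exprSr prednK ?expf_card //.
exact: ltnW (finNzRing_gt1 F).
Qed.

(** Division with remainder of [ord x] by E in the Z-group: [tau] has the quotient as its order, and
    what remains after the remainder pi^i is a unit. *)
Lemma euclid_pow E x : (0 < E)%N -> x != 0 -> exists tau i w,
  [/\ (i < E)%N, tau != 0, veq w 1 & x = pi ^+ i * tau ^+ E * w].
Proof.
move=> E0 nx; have [g Eg] := ord_neq0 nx.
case: zgroup => _ _ _ _ [e [e0 e1 emin ediv]].
case: Hpi => e' [Ee' e'0 e'1 e'min].
(* Least positive elements are unique, so the remainder is a multiple of [ord pi]. *)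
have Ee : ord pi = Some e by rewrite Ee'; congr Some; apply: le_anti; auto.
have [h [i [iE Eh]]] := ediv E E0 g.
case: valued => _ _ _ /(_ h)[tau Et].
have ntau := ord_Some_neq0 Et.
have nb : pi ^+ i * tau ^+ E != 0 by rewrite mulf_neq0 ?expf_neq0 ?pi_neq0.
exists tau, i, ((pi ^+ i * tau ^+ E)^-1 * x); split=> //; last by rewrite mulVKf.
apply: veq_mulVl => //; apply: veq_same_ord.
by rewrite Eg ordM (ordX _ Ee) (ordX _ Et) /= addrC -Eh.
Qed.

(** * Cosets of (K^x)^E (1 + pi^M R_K) *)

Section Near.

Variables E M : nat.
Hypothesis M0 : (0 < M)%N.
Hypothesis E0 : (0 < E)%N.
Hypothesis HE : forall w, veq w 1 -> cong1 M (w ^+ E).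

(* Lying in the same coset of (K^x)^E (1 + pi^M R_K) refines every [rho_eq n m]
   with n | E and m <= M, whether or not angular components exist. *)
Definition near x y :=
  exists t v, [/\ t != 0, cong1 M v & x = y * t ^+ E * v].

Lemma cong1_neq0 v : cong1 M v -> v != 0.
Proof.
by move=> /(cong1_unit M0)/veq_neq0 ->; apply: oner_neq0.
Qed.

Lemma near_refl x : near x x.
Proof.
by exists 1, 1; rewrite oner_neq0 expr1n !mulr1; split=> //; apply: cong1_1.
Qed.

Lemma near_sym x y : near x y -> near y x.
Proof.
case=> t [v [nt hv ->]]; have nv := cong1_neq0 hv.
exists t^-1, v^-1; split; rewrite ?invr_neq0 //; first exact: cong1V.
by rewrite exprVn; field; rewrite nv expf_neq0.
Qed.

Lemma near_trans y x z : near x y -> near y z -> near x z.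
Proof.
case=> t [v [nt hv ->]] [s [w [ns hw ->]]].
exists (s * t), (w * v); split; [exact: mulf_neq0 | exact: cong1M |].
by rewrite exprMn; ring.
Qed.

Lemma near_mul2l c x y : near x y -> near (c * x) (c * y).
Proof. by case=> t [v [nt hv ->]]; exists t, v; split=> //; rewrite !mulrA. Qed.

Lemma near_cong1 x v : cong1 M v -> near (x * v) x.
Proof.
by move=> hv; exists 1, v; rewrite oner_neq0 expr1n mulr1.
Qed.

Lemma near_eq0 x y : near x y -> (x == 0) = (y == 0).
Proof.
case=> t [v [nt hv ->]]; rewrite !mulf_eq0 (negPf (cong1_neq0 hv)).
by rewrite expf_eq0 (negPf nt) andbF !orbF.
Qed.

(** Equality of orders gives t^E order 0. The value group being ordered, t is then a unit, and [HE]
    puts t^E into 1 + pi^M R_K. *)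
Lemma near_veq x y : y != 0 -> near x y -> veq x y ->
  exists2 v, cong1 M v & x = y * v.
Proof.
move=> ny [t [v [nt hv ->]]] h; exists (t ^+ E * v); last by rewrite mulrA.
apply: cong1M => //.
have tE : veq (t ^+ E) 1.
  apply: veq_trans (_ : veq (t ^+ E) (t ^+ E * v)) _.
    rewrite -{1}[t ^+ E]mulr1 veq_mul ?veqxx //.
    by rewrite veq_sym; apply: (cong1_unit M0).
  by rewrite -(mulVf ny); have := veq_mulVl ny h; rewrite mulVf // !mulrA mulVf // mul1r.
apply: HE; rewrite /veq; have /orP[t1|t1] := vle_total t 1.
  rewrite t1 /=; case: E E0 tE => // n _; rewrite exprS => /andP[_ tE].
  have nt' : t^-1 != 0 by rewrite invr_neq0.
  have tn : vle 1 (t^-1 ^+ n).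
    apply: vle_exp1; rewrite -(vle_pmul2l _ _ nt) mulfV // mulr1 //.
  have := vle_mul tE tn; rewrite mulr1 exprVn mulfK ?expf_neq0 //.
rewrite t1 andbT; case: E E0 tE => // n _; rewrite exprS => /andP[tE _].
apply: vle_trans tE; rewrite -{1}[t]mulr1; apply: vle_mul2l; exact: vle_exp1.
Qed.

Lemma congr_pim_trans m a b c :
  congr_pim le ord pi m a b -> congr_pim le ord pi m b c ->
  congr_pim le ord pi m a c.
Proof.
move=> h1 h2; have := @vle_add (pi ^+ m) (a - b) (b - c) h1 h2.
by rewrite addrA subrK.
Qed.

Lemma congr_pim_sym m a b :
  congr_pim le ord pi m a b -> congr_pim le ord pi m b a.
Proof. by move=> h; have := @vle_opp (pi ^+ m) (a - b) h; rewrite opprB. Qed.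

Lemma congr_pim_mul m a b c : vle 1 c ->
  congr_pim le ord pi m a b -> congr_pim le ord pi m (c * a) (c * b).
Proof.
move=> c1 h; have := @vle_mul 1 c (pi ^+ m) (a - b) c1 h.
by rewrite mul1r mulrBr.
Qed.

Lemma rho_eq_sym n m x y :
  rho_eq le ord pi n m x y -> rho_eq le ord pi n m y x.
Proof.
case=> [[-> ->]|[nx ny [a [b [z [Ea Eb Ez]]]] H]]; first by left.
right; split=> //; last by move=> ac /H; apply: congr_pim_sym.
by exists b, a, (- z); rewrite mulNrn -Ez opprB.
Qed.

Lemma rho_eq_trans n m y x z : rho_eq le ord pi n m x y ->
  rho_eq le ord pi n m y z -> rho_eq le ord pi n m x z.
Proof.
case=> [[-> ->]|[nx ny [a [b [c [Ea Eb Ec]]]] H]].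
  by case=> [[_ ->]|[]]; [left | rewrite eqxx].
case=> [[y0 _]|[_ nz [b' [d [c' [Eb' Ed Ec']]]] H']]; first by rewrite y0 eqxx in ny.
right; split=> //; last first.
  by move=> ac hac; apply: congr_pim_trans (H _ hac) (H' _ hac).
exists a, d, (c + c'); split=> //; rewrite mulrnDl -Ec -Ec'.
by move: Eb'; rewrite Eb => -[->]; rewrite addrA subrK.
Qed.

Lemma ac_specX m ac t n : ac_spec le ord pi m ac -> t != 0 ->
  congr_pim le ord pi m (ac (t ^+ n)) (ac t ^+ n).
Proof.
case=> ac0 acM _ acu nt.
have ac1 x : x != 0 -> vle 1 (ac x) by move=> nx; rewrite /vle ac0 // ord_one /=.
elim: n => [|n IH]; first by rewrite !expr0; apply: acu; apply: ord_one.
rewrite !exprS; apply: congr_pim_trans (acM _ _ nt _) _; first by rewrite expf_neq0.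
by apply: congr_pim_mul => //; apply: ac1.
Qed.

(** The factor t^E shifts the order by a multiple of n, and its angular component is an E-th power
    of a unit, hence 1 modulo pi^m by [HE]. The factor v has order 0 and angular component congruent
    to v, hence to 1. *)
Lemma near_rho_eq n m x y : (n %| E)%N -> (m <= M)%N -> near x y ->
  rho_eq le ord pi n m x y.
Proof.
move=> nE mM xy; have [y0|ny] := eqVneq y 0.
  by left; split=> //; apply/eqP; rewrite (near_eq0 xy) y0.
have nx : x != 0 by rewrite (near_eq0 xy).
case: xy => t [v [nt hv Ex]]; right; split=> //.
  have [[[a Ea] [b Eb]] [c Ec]] := (ord_neq0 nx, ord_neq0 ny, ord_neq0 nt).
  exists a, b, (c *+ (E %/ n)); split=> //; rewrite -mulrnA divnK //.
  have [g Eg] := ord_neq0 (cong1_neq0 hv).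
  have g0 : g = 0 by apply/(veq_ord Eg); apply: (cong1_unit M0).
  move: Ea; rewrite Ex !ordM Eb (ordX _ Ec) Eg g0 /= => -[<-].
  by rewrite addr0 addrAC subrr add0r.
move=> ac hac; have [ac0 acM acpi acu] := hac.
have acN z : z != 0 -> veq (ac z) 1.
  by move=> nz; apply/(veq_ord (ac0 _ nz)).
have nv := cong1_neq0 hv; have nyt : y * t ^+ E != 0 by rewrite mulf_neq0 ?expf_neq0.
rewrite Ex; apply: congr_pim_trans (acM _ _ nyt nv) _.
have v1 : congr_pim le ord pi m (ac v) 1.
  apply: (@congr_pim_trans _ _ v); last by apply: (cong1W mM hv).
  apply: acu; have [g Eg] := ord_neq0 nv; rewrite Eg; congr Some.
  by apply/(veq_ord Eg); apply: (cong1_unit M0).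
have acge z : z != 0 -> vle 1 (ac z) by move=> /acN/andP[].
apply: congr_pim_trans (congr_pim_mul (acge _ nyt) v1) _; rewrite mulr1.
apply: congr_pim_trans (acM _ _ ny _) _; first by rewrite expf_neq0.
rewrite -{2}[ac y]mulr1; apply: congr_pim_mul; first exact: acge.
apply: congr_pim_trans (ac_specX E hac nt) _.
by apply: (cong1W mM); apply: HE; apply: acN.
Qed.

(** Dividing a congruence modulo pi^M by a unit keeps its precision, so representatives modulo pi^M
    also represent the units up to 1 + pi^M R_K. *)
Lemma unit_reps : exists S : seq K, forall w, veq w 1 ->
  exists s v, [/\ List.In s S, veq s 1, cong1 M v & s = w * v].
Proof.
have [S HS] := residue_reps_pow M; exists S => w w1.
have [|s Ss ws] := HS w; first by case/andP: w1.
have nw : w != 0 by rewrite (veq_neq0 w1) oner_neq0.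
have hv : cong1 M (w^-1 * s).
  rewrite /cong1 -(vle_pmul2l _ _ nw) mulrBr mulVKf // mulr1 -opprB.
  apply: vle_opp; apply: vle_trans ws; rewrite -{2}[pi ^+ M]mul1r.
  by apply: vle_mul; [case/andP: w1 | apply: vlexx].
exists s, (w^-1 * s); split=> //; last by rewrite mulVKf.
rewrite -[s](mulVKf nw) -[1]mulr1; apply: veq_mul => //.
exact: cong1_unit hv.
Qed.

(** Serves for the largest and the smallest order in a list and for the nearest centre. *)
Lemma exists_extremum (A : Type) (r : rel A) (P : pred A) (s : seq A) a0 :
  total r -> transitive r -> List.In a0 s -> P a0 ->
  exists a, [/\ List.In a s, P a & forall b, List.In b s -> P b -> r b a].
Proof.
move=> rtot rtr; elim: s a0 => //= b s IH a0 Ha Pa.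
have rr a : r a a by have := rtot a a; rewrite orbb.
have [[c [cs Pc]]|H] := classic (exists c, List.In c s /\ P c).
  have [a [as_ Pa' Ha']] := IH _ cs Pc.
  have [/andP[Pb ab]|nb] := boolP (P b && r a b).
    exists b; split=> //; first by left.
    by move=> d [<-|ds] Pd //; apply: rtr ab; apply: Ha'.
  exists a; split=> //; first by right.
  move=> d [<-|ds] Pd; last exact: Ha'.
  by move: nb; rewrite Pd /=; have := rtot b a; case: (r b a) => //= ->.
have Pb : P b by case: Ha => [->//|ha]; case: H; exists a0.
exists b; split=> //; first by left.
by move=> d [<-|ds] Pd //; case: H; exists d.
Qed.

(** * Test points with prescribed coset and position *)

Definition same_pos d u u' := vle d u = vle d u' /\ vle u d = vle u' d.

Lemma piSn n : ~~ vle (pi ^+ n.+1) (pi ^+ n).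
Proof.
rewrite exprSr -{2}[pi ^+ n]mulr1 vle_pmul2l ?piX_neq0 //; exact: vlepi1.
Qed.

(* Test points: up to [near], an element is represented in its position
   relative to [ds] by a bounded multiple of the largest element of [ds] below
   it, or, if there is none, of the smallest element of [ds]. *)
Lemma position_reps : exists Kap : seq K, forall (ds : seq K) u,
  List.In 1 ds -> u != 0 -> exists kap d,
  [/\ List.In kap Kap, List.In d ds, kap * d != 0, near (kap * d) u
    & forall d', List.In d' ds -> same_pos d' u (kap * d)].
Proof.
have [S HS] := unit_reps.
(* The base factor is 1 if [u] has the order of [d], pi if [u] lies strictly above [d], and pi^-E if
   [u] lies below all of [ds]. Then pi^i corrects the order modulo E and [s] the unit part. *)
pose Kap := List.flat_map (fun a => List.flat_map (fun i =>
  List.map (fun s => a * pi ^+ i * s) S) (iota 0 E)) [:: 1; pi; pi ^- E].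
have KapP a i s : List.In a [:: 1; pi; pi ^- E] -> (i < E)%N -> List.In s S ->
    List.In (a * pi ^+ i * s) Kap.
  move=> Ha Hi Hs; apply/List.in_flat_map; exists a; split=> //.
  apply/List.in_flat_map; exists i; split.
    have : i \in iota 0 E by rewrite mem_iota.
    elim: (iota 0 E) => // b t IH; rewrite inE => /predU1P[->|/IH]; first by left.
    by right.
  by apply: (List.in_map (fun s => a * pi ^+ i * s)).
(* Dropping the E-th power of [tau] from u / b preserves the coset and leaves a bounded multiple of
   [b]. *)
have dec b u : b != 0 -> u != 0 -> exists i tau s,
    [/\ (i < E)%N, List.In s S, veq s 1, near (b * pi ^+ i * s) u
      & veq u (b * pi ^+ i * tau ^+ E)].
  move=> nb nu; have nbu : b^-1 * u != 0 by rewrite mulf_neq0 ?invr_neq0.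
  have [tau [i [w [iE ntau w1 Eu]]]] := euclid_pow E0 nbu.
  have {}Eu : u = b * pi ^+ i * tau ^+ E * w by rewrite -(mulVKf nb u) Eu; ring.
  have [s [v [Ss s1 hv Es]]] := HS w w1.
  exists i, tau, s; split=> //.
    exists tau^-1, v; split; rewrite ?invr_neq0 // Es Eu exprVn.
    by field; rewrite expf_neq0.
  by rewrite Eu -{2}[_ * tau ^+ E]mulr1 veq_mul ?veqxx.
exists Kap => ds u d1 nu.
have [[d0 [ds0 d0u]]|Hno] := classic (exists d, List.In d ds /\ vle d u).
  have [] := @exists_extremum K vle (vle^~ u) ds d0 vle_total _ ds0 d0u.
    by move=> y x z; apply: vle_trans.
  move=> d [dsd du dmax].
  have nd : d != 0 by apply: contra nu => /eqP d_0; rewrite -vle0l -d_0.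
  have [ud|nud] := boolP (vle u d).
    have w1 : veq (d^-1 * u) 1 by rewrite veq_mulVl // /veq ud du.
    have [s [v [Ss s1 hv Es]]] := HS _ w1.
    exists s, d; split=> //.
    - by have := KapP 1 0%N s; rewrite expr0 !mul1r; apply; [left | |].
    - by rewrite mulf_neq0 // (veq_neq0 s1) oner_neq0.
    - rewrite Es; have -> : d^-1 * u * v * d = u * v by field.
      exact: near_cong1.
    - have H : veq (s * d) u.
        rewrite -[u]mul1r; apply: veq_mul => //; by rewrite /veq ud du.
      by move=> d' _; split; apply: veq_vle; rewrite ?veqxx // veq_sym.
  have pdu := vlt_pi nud.
  have npd : pi * d != 0 by rewrite mulf_neq0 ?pi_neq0.
  have [i [tau [s [iE Ss s1 nr Hu]]]] := dec _ _ npd nu.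
  have ns : s != 0 by rewrite (veq_neq0 s1) oner_neq0.
  pose u' := pi * pi ^+ i * s * d.
  have Eu' : pi * d * pi ^+ i * s = u' by rewrite /u'; ring.
  have vu' : veq u' (pi * d * pi ^+ i).
    by rewrite -Eu' -{2}[_ * pi ^+ i]mulr1 veq_mul ?veqxx.
  have pu' : vle (pi * d) u'.
    rewrite (veq_vle (veqxx (pi * d)) vu') -{1}[pi * d]mulr1.
    by rewrite vle_pmul2l // vle_piX.
  have u'u : vle u' u.
    rewrite (veq_vle vu' Hu) -{1}[_ * pi ^+ i]mulr1.
    rewrite vle_pmul2l; last by rewrite mulf_neq0 ?piX_neq0.
    have [t1|t1] := boolP (vle 1 tau); first exact: vle_exp1.
    (* If [tau] had negative order, its E-th power would have order at most -E, and i < E would put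
       [u] strictly below pi d. *)
    exfalso; have pt : vle (pi * tau) 1 := vlt_pi t1.
    have ptE : vle ((pi * tau) ^+ E) 1.
      elim: E => [|n IH]; first by rewrite expr0 vlexx.
      by rewrite exprS -[X in vle _ X]mulr1 vle_mul.
    have h1 : vle 1 (pi ^+ i * tau ^+ E).
      rewrite -(vle_pmul2l _ _ npd) mulr1 mulrA.
      by rewrite -(veq_vle (veqxx (pi * d)) Hu).
    have h2 := vle_trans ptE h1; move: h2; rewrite exprMn => h2.
    have nt : tau != 0.
      by apply/eqP=> t0; move: t1; rewrite t0 vle0r.
    move: h2; rewrite ![_ * tau ^+ E]mulrC vle_pmul2l ?expf_neq0 // => h2.
    by move/negP: (piSn i); apply; apply: vle_trans h2; apply: vle_piX2.
  exists (pi * pi ^+ i * s), d; rewrite -/u' -Eu'; split=> //.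
  - by apply: KapP; [right; left | |].
  - by rewrite !mulf_neq0 ?piX_neq0 ?pi_neq0.
  rewrite Eu' => d' dsd'; split; apply/idP/idP => h.
  - apply: vle_trans pu'; apply: vle_trans (dmax _ dsd' h) _.
    by rewrite -{1}[d]mul1r vle_mul ?vlexx ?vle1pi.
  - exact: vle_trans h u'u.
  - exact: vle_trans u'u h.
  (* By maximality of [d], an element d' below [u] has order at most that of [d], whereas the test
     point lies at least one step above [d]. *)
  - apply/negPn/negP=> /vleNge hd; move/negP: vlepi1; apply.
    rewrite -(vle_pmul2l _ _ nd) mulr1 mulrC.
    exact: vle_trans (vle_trans pu' h) (dmax _ dsd' hd).
(* Nothing in [ds] lies below [u]: the element of smallest order, nonzero because 1 is in [ds], is
   shifted by pi^-E, and i < E keeps the test point strictly below it. *)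
have [] := @exists_extremum K (fun x y => vle y x) predT ds 1 _ _ d1 isT.
- by move=> x y; apply: vle_total.
- by move=> y x z h1 h2; apply: vle_trans h1.
move=> d [dsd _ dmin].
have nd : d != 0.
  by apply/eqP=> d_0; have := dmin _ d1 isT; rewrite d_0 vle0l oner_eq0.
have npd : d * pi ^- E != 0 by rewrite mulf_neq0 ?invr_neq0 ?piX_neq0.
have [i [tau [s [iE Ss s1 nr Hu]]]] := dec _ _ npd nu.
have ns : s != 0 by rewrite (veq_neq0 s1) oner_neq0.
pose u' := pi ^- E * pi ^+ i * s * d.
have Eu' : d * pi ^- E * pi ^+ i * s = u' by rewrite /u'; ring.
have nud : ~~ vle d u'.
  rewrite -(@veq_vle d d (d * pi ^- E * pi ^+ i)) ?veqxx //; last first.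
    by rewrite -Eu' -{1}[_ * pi ^+ i]mulr1 veq_mul ?veqxx // veq_sym.
  rewrite -{1}[d]mulr1 -mulrA vle_pmul2l // -(vle_pmul2l _ _ (piX_neq0 E)).
  rewrite mulr1 mulVKf ?piX_neq0 //; apply: contra (piSn i) => h.
  by apply: vle_trans h; apply: vle_piX2.
exists (pi ^- E * pi ^+ i * s), d; rewrite -/u' -Eu'; split=> //.
- by apply: KapP; [right; right; left | |].
- by rewrite !mulf_neq0 ?invr_neq0 ?piX_neq0.
rewrite Eu' => d' dsd'.
have nu1 : ~~ vle d' u by apply/negP=> h; case: Hno; exists d'.
have dd' := dmin _ dsd' isT.
have nu2 : ~~ vle d' u' by apply: contra nud => h; apply: vle_trans h.
by split; [rewrite (negPf nu1) (negPf nu2) | rewrite (vleNge nu1) (vleNge nu2)].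
Qed.

(** * Cosets and orders under translation *)

Lemma small_add a b : a != 0 -> vle (pi ^+ M * a) b ->
  near (a + b) a /\ veq (a + b) a.
Proof.
move=> na h; have hv : cong1 M (1 + a^-1 * b).
  by rewrite /cong1 addrAC subrr add0r -(vle_pmul2l _ _ na) mulVKf // mulrC.
have -> : a + b = a * (1 + a^-1 * b) by rewrite mulrDr mulr1 mulVKf.
split; first exact: near_cong1.
rewrite -[X in veq _ X]mulr1; apply: veq_mul; first exact: veqxx.
exact: cong1_unit hv.
Qed.

(** Here u' = u v with v in 1 + pi^M R_K, and the error (v - 1) u is negligible against u + d, whose
    order does not exceed that of u. *)
Lemma near_shift_veq u u' d : u != 0 -> near u' u -> veq u' u ->
  vle (u + d) u -> near (u' + d) (u + d) /\ veq (u' + d) (u + d).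
Proof.
move=> nu nr vq h; have [v hv Eu'] := near_veq nu nr vq.
have nud : u + d != 0 by apply: contra nu => /eqP h0; rewrite h0 vle0l in h.
have -> : u' + d = (u + d) + (v - 1) * u by rewrite Eu'; ring.
by apply: small_add => //; apply: vle_mul.
Qed.

(** The points pi^(j - M) d span a window of radius M around the order of [d]. Outside it one
    summand dominates and absorbs the other; inside it, equal positions would force [u] and [u'] to
    have equal order. *)
Lemma near_shift u u' d : u != 0 -> u' != 0 -> near u' u -> ~~ veq u' u ->
  (forall j, (j <= M + M)%N -> same_pos (pi ^+ j * (pi ^- M * d)) u u') ->
  near (u' + d) (u + d) /\
  (veq (u + d) u /\ veq (u' + d) u' \/ veq (u + d) d /\ veq (u' + d) d).
Proof.
move=> nu nu' nr nvq Hpos.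
have [d0|nd] := eqVneq d 0; first by rewrite d0 !addr0 !veqxx; auto.
have [h|h] := boolP (vle (pi ^+ (M + M) * (pi ^- M * d)) u).
  have h' := h; rewrite (proj1 (Hpos _ (leqnn _))) in h'.
  move: h h'; rewrite exprD -mulrA mulVKf ?piX_neq0 // => h h'.
  have [n1 v1] := small_add nd h; have [n2 v2] := small_add nd h'.
  rewrite ![_ + d]addrC; split; last by right.
  by apply: near_trans n2 _; apply: near_sym.
have [hw|hw] := boolP (vle (pi ^- M * d) u).
  have [j jM vj] := pi_interval hw h.
  case/negP: nvq; apply: (@veq_trans (pi ^+ j * (pi ^- M * d))).
    by case: (Hpos j (ltnW jM)) => e1 e2; rewrite /veq -e1 -e2.
  by rewrite veq_sym.
have small z : vle z (pi ^- M * d) -> vle (pi ^+ M * z) d.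
  by rewrite -(vle_pmul2l z _ (piX_neq0 M)) mulVKf ?piX_neq0.
have h1 := vleNge hw.
have h2 : vle u' (pi ^- M * d).
  by have [_] := Hpos 0%N isT; rewrite expr0 mul1r h1 => <-.
have [n1 v1] := small_add nu (small _ h1).
have [n2 v2] := small_add nu' (small _ h2).
split; last by left.
by apply: near_trans n2 (near_trans nr _); apply: near_sym.
Qed.

(** * Affine forms in one variable and their test terms *)

Definition form_val (e : nat -> K) (p : K * term K) x := p.1 * x + teval e p.2.

(** The data that decide every atom built from the forms in [L], as [sat_agree] shows. *)
Definition agree L e x x' :=
  (forall p, List.In p L -> near (form_val e p x') (form_val e p x)) /\
  (forall p p', List.In p L -> List.In p' L ->
    vle (form_val e p x) (form_val e p' x) =
    vle (form_val e p x') (form_val e p' x')).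

Lemma In_pairs (A B C : Type) (f : A -> B -> C) s t x y :
  List.In x s -> List.In y t ->
  List.In (f x y) (List.flat_map (fun x => List.map (f x) t) s).
Proof.
move=> sx ty; apply/List.in_flat_map; exists x; split=> //.
exact: (List.in_map (f x)).
Qed.

(* With c the centre nearest to x, and u' the test point for u = x - c
   relative to all relevant orders, c + u' agrees with x on every form. *)
Lemma test_terms (L : seq (K * term K)) : exists T : seq (term K),
  forall e x, exists2 t, List.In t T & agree L e x (teval e t).
Proof.
have [Kap HKap] := position_reps.
(* The centres are the zeros -b/a of the forms a x + b. Since the inverse of 0 is 0, a constant form
   only adds a centre of value 0; [TConst 0] keeps the list nonempty. *)
pose C := TConst 0 :: List.map (fun p => TScal (- p.1^-1) p.2) L.
pose CC := List.flat_map (fun c => List.map (TSub c) C) C.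
(* Terms that may carry the order of a form: its constant part if a = 0, and a (c - c') if the
   difference of centres dominates x - c. *)
pose H := List.app (List.map snd L)
  (List.flat_map (fun p : K * term K => List.map (TScal p.1) CC) L).
(* The quotients h / a decide comparisons of a u with [H]; the multiples pi^(j - M) (c - c') are the
   windows of [near_shift]; the constant 1 is required by [HKap]. *)
pose D := TConst 1 :: List.app
  (List.flat_map (fun p : K * term K => List.map (TScal p.1^-1) H) L)
  (List.flat_map (fun j => List.map (fun t => TScal (pi ^+ j) (TScal (pi ^- M) t)) CC)
    (List.seq 0 (M + M).+1)).
pose T := List.app C (List.flat_map (fun c => List.map (TAdd c)
  (List.flat_map (fun kap => List.map (TScal kap) D) Kap)) C).
exists T => e x.
have [[c [Cc xc]]|nC] := classic (exists c, List.In c C /\ x = teval e c).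
  exists c; first by apply/List.in_or_app; left.
  by rewrite -xc; split=> // p _; apply: near_refl.
have [] := @exists_extremum _ (fun c c' => vle (x - teval e c) (x - teval e c'))
  predT C (TConst 0) _ _ _ isT; try by left.
- by move=> c c'; apply: vle_total.
- by move=> c' c c''; apply: vle_trans.
move=> c [Cc _ cmax]; set u := x - teval e c.
have nu : u != 0.
  by rewrite subr_eq0; apply/eqP=> xc; case: nC; exists c.
have [] := HKap (List.map (teval e) D) u _ nu; first by left.
move=> kap [_ [Hkap /List.in_map_iff[d [<- Dd]] nu' nr Hpos]].
set u' := kap * teval e d in nu' nr Hpos.
exists (TAdd c (TScal kap d)).
  by apply/List.in_or_app; right; apply: In_pairs => //; apply: In_pairs.
have Et : teval e (TAdd c (TScal kap d)) = teval e c + u' by [].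
rewrite {}Et.
have posD t : List.In t D -> same_pos (teval e t) u u'.
  by move=> Dt; apply: Hpos; apply: List.in_map.
(* With c' the zero of the form, its value at x is a (x - c'), and [c] being nearest bounds the
   order of x - c' by that of [u]. *)
have center p : List.In p L -> p.1 != 0 -> exists c',
    [/\ List.In c' C, vle (u + (teval e c - teval e c')) u
      , form_val e p x = p.1 * (u + (teval e c - teval e c'))
      & form_val e p (teval e c + u') = p.1 * (u' + (teval e c - teval e c'))].
  case: p => a b /= Lp na; exists (TScal (- a^-1) b).
  have Cp : List.In (TScal (- a^-1) b) C.
    by right; apply: (List.in_map (fun p => TScal (- p.1^-1) p.2) _ (a, b)).
  split=> //; try by rewrite /form_val /u /=; field.
  by rewrite addrA subrK; apply: cmax Cp isT.
have CCp c' : List.In c' C -> List.In (TSub c c') CC by move=> ?; apply: In_pairs.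
have [vq|nvq] := boolP (veq u' u).
  have main p : List.In p L ->
      near (form_val e p (teval e c + u')) (form_val e p x) /\
      veq (form_val e p (teval e c + u')) (form_val e p x).
    move=> Lp; have [p0|np] := eqVneq p.1 0.
      rewrite /form_val p0 !mul0r veqxx; split=> //; exact: near_refl.
    have [c' [_ hc' -> ->]] := center p Lp np.
    have [h1 h2] := near_shift_veq nu nr vq hc'.
    by split; [apply: near_mul2l | apply: veq_mul; rewrite ?veqxx].
  split=> [p /main[]//|p p' /main[_ h1] /main[_ h2]].
  by apply: veq_vle; rewrite veq_sym.
(* Each form has, at x and at the test point alike, either the order of a times the displacement
   from [c] or that of one fixed term in [H]. *)
have main p : List.In p L ->
    near (form_val e p (teval e c + u')) (form_val e p x) /\
    ([/\ p.1 != 0, veq (form_val e p x) (p.1 * u) &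
       veq (form_val e p (teval e c + u')) (p.1 * u')] \/
     exists2 h, List.In h H &
       veq (form_val e p x) (teval e h) /\
       veq (form_val e p (teval e c + u')) (teval e h)).
  move=> Lp; have [p0|np] := eqVneq p.1 0.
    rewrite /form_val p0 !mul0r !add0r; split; first exact: near_refl.
    right; exists p.2; last by rewrite veqxx.
    by apply/List.in_or_app; left; apply: List.in_map.
  have [c' [Cc' hc' -> ->]] := center p Lp np.
  have [|h1 h2] := near_shift (d := teval e c - teval e c') nu nu' nr nvq.
    move=> j jM; apply: (posD (TScal (pi ^+ j) (TScal (pi ^- M) (TSub c c')))).
    right; apply/List.in_or_app; right.
    apply: (In_pairs (fun j t => TScal (pi ^+ j) (TScal (pi ^- M) t))).
      by apply/List.in_seq; split; [apply/leP | apply/ltP].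
    exact: CCp.
  split; first exact: near_mul2l.
  case: h2 => -[h2 h3]; [left | right].
    by split=> //; apply: veq_mul; rewrite ?veqxx.
  exists (TScal p.1 (TSub c c')).
    apply/List.in_or_app; right.
    by apply: (In_pairs (fun p : K * term K => TScal p.1)) => //; apply: CCp.
  by split=> /=; apply: veq_mul; rewrite ?veqxx.
have posH p h : List.In p L -> p.1 != 0 -> List.In h H ->
    vle (p.1 * u) (teval e h) = vle (p.1 * u') (teval e h) /\
    vle (teval e h) (p.1 * u) = vle (teval e h) (p.1 * u').
  move=> Lp np Hh; have Eh : teval e h = p.1 * teval e (TScal p.1^-1 h).
    by rewrite /= mulVKf.
  rewrite Eh !vle_pmul2l //; case: (posD (TScal p.1^-1 h)) => //.
  right; apply/List.in_or_app; left.
  by apply: (In_pairs (fun p : K * term K => TScal p.1^-1)).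
split=> [p /main[]//|p p' Lp Lp'].
have [_ h1] := main p Lp; have [_ h2] := main p' Lp'.
case: h1 => [[np a1 a2]|[h Hh [a1 a2]]]; case: h2 => [[np' b1 b2]|[h' Hh' [b1 b2]]];
  rewrite (veq_vle a1 b1) (veq_vle a2 b2).
(* Both comparisons reduce to the leading coefficients. *)
- by rewrite ![_ * u]mulrC ![_ * u']mulrC !vle_pmul2l.
- by have [] := posH p h'.
- by have [] := posH p' h.
- by [].
Qed.

End Near.
Local Notation sat := (sat le ord pi).

(** * Quantifier-free formulas and substitution *)

Fixpoint qf (f : formula K) : bool :=
  match f with
  | FEq _ _ | FDiv _ _ | FR _ _ _ _ _ => true
  | FNot f1 => qf f1
  | FAnd f1 f2 | FOr f1 f2 => qf f1 && qf f2
  | FEx _ _ | FAll _ _ => false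
  end.

Fixpoint tsub (s : nat -> term K) (t : term K) : term K :=
  match t with
  | TVar i => s i
  | TConst c => TConst c
  | TAdd t1 t2 => TAdd (tsub s t1) (tsub s t2)
  | TSub t1 t2 => TSub (tsub s t1) (tsub s t2)
  | TScal c t1 => TScal c (tsub s t1)
  end.

(* Only meaningful on quantifier-free formulas: no renaming of bound variables. *)
Fixpoint fsub (s : nat -> term K) (f : formula K) : formula K :=
  match f with
  | FEq t1 t2 => FEq (tsub s t1) (tsub s t2)
  | FDiv t1 t2 => FDiv (tsub s t1) (tsub s t2)
  | FR n m t1 t2 t3 => FR n m (tsub s t1) (tsub s t2) (tsub s t3)
  | FNot f1 => FNot (fsub s f1)
  | FAnd f1 f2 => FAnd (fsub s f1) (fsub s f2)
  | FOr f1 f2 => FOr (fsub s f1) (fsub s f2)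
  | FEx _ _ | FAll _ _ => f
  end.

Lemma teval_ext (e e' : nat -> K) t : e =1 e' -> teval e t = teval e' t.
Proof. by move=> ee'; elim: t => //= [t1 -> t2 ->|t1 -> t2 ->|c t ->]. Qed.

Lemma upd_ext (e e' : nat -> K) i a : e =1 e' -> upd e i a =1 upd e' i a.
Proof. by move=> ee' j; rewrite /upd ee'. Qed.

Lemma sat_ext f e e' : e =1 e' -> sat e f <-> sat e' f.
Proof.
elim: f e e' => [t1 t2|t1 t2|n m t1 t2 t3|f IH|f1 IH1 f2 IH2|f1 IH1 f2 IH2
  |i f IH|i f IH] e e' ee' /=.
- by rewrite !(teval_ext _ ee').
- by rewrite !(teval_ext _ ee').
- by rewrite !(teval_ext _ ee').
- by rewrite (IH _ _ ee').
- by rewrite (IH1 _ _ ee') (IH2 _ _ ee').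
- by rewrite (IH1 _ _ ee') (IH2 _ _ ee').
- have H a := IH _ _ (upd_ext i a ee').
  by split=> -[a h]; exists a; apply/(H a).
- have H a := IH _ _ (upd_ext i a ee').
  by split=> h a; apply/(H a).
Qed.

Lemma teval_tsub e s t : teval e (tsub s t) = teval (fun i => teval e (s i)) t.
Proof. by elim: t => //= [t1 -> t2 ->|t1 -> t2 ->|c t ->]. Qed.

Lemma sat_fsub e s f : qf f ->
  sat e (fsub s f) <-> sat (fun i => teval e (s i)) f.
Proof.
elim: f => //= [t1 t2|t1 t2|n m t1 t2 t3|f IH|f1 IH1 f2 IH2|f1 IH1 f2 IH2].
- by rewrite !teval_tsub.
- by rewrite !teval_tsub.
- by rewrite !teval_tsub.
- by move=> /IH ->.
- by move=> /andP[/IH1 -> /IH2 ->].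
- by move=> /andP[/IH1 -> /IH2 ->].
Qed.

Lemma qf_fsub s f : qf (fsub s f) = qf f.
Proof. by elim: f => //= f1 -> f2 ->. Qed.

(** * Atoms as conditions on affine forms in one variable *)

Definition sub1 i (t : term K) j : term K := if j == i then t else TVar K j.

Lemma teval_sub1 e i t : (fun j => teval e (sub1 i t j)) =1 upd e i (teval e t).
Proof. by move=> j; rewrite /sub1 /upd; case: eqP. Qed.

Fixpoint coef i (t : term K) : K :=
  match t with
  | TVar j => (j == i)%:R
  | TConst _ => 0
  | TAdd t1 t2 => coef i t1 + coef i t2
  | TSub t1 t2 => coef i t1 - coef i t2
  | TScal c t1 => c * coef i t1
  end.

Definition form i t := (coef i t, tsub (sub1 i (TConst 0)) t).

Lemma teval_form e i a t : teval (upd e i a) t = form_val e (form i t) a.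
Proof.
rewrite /form_val /=; elim: t => /=.
- move=> j; rewrite /upd /sub1; case: eqP => _ /=; ring.
- by move=> c; ring.
- by move=> t1 -> t2 ->; ring.
- by move=> t1 -> t2 ->; ring.
- by move=> c t ->; ring.
Qed.

(** An equality is read as the vanishing of a difference, which [near] preserves. *)
Fixpoint fterms (f : formula K) : seq (term K) :=
  match f with
  | FEq t1 t2 => [:: TSub t1 t2]
  | FDiv t1 t2 => [:: t1; t2]
  | FR _ _ t1 t2 t3 => [:: TSub t2 t1; t3]
  | FNot f1 => fterms f1
  | FAnd f1 f2 | FOr f1 f2 => List.app (fterms f1) (fterms f2)
  | FEx _ _ | FAll _ _ => [::]
  end.

(** A common multiple of the moduli, to divide the exponent E; [fprec] is likewise a common bound
    for the precisions. *)
Fixpoint fmod (f : formula K) : nat :=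
  match f with
  | FR n _ _ _ _ => n.+1
  | FNot f1 => fmod f1
  | FAnd f1 f2 | FOr f1 f2 => fmod f1 * fmod f2
  | _ => 1
  end.

Fixpoint fprec (f : formula K) : nat :=
  match f with
  | FR _ m _ _ _ => m.+1
  | FNot f1 => fprec f1
  | FAnd f1 f2 | FOr f1 f2 => maxn (fprec f1) (fprec f2)
  | _ => 1
  end.

Lemma fmod_gt0 f : (0 < fmod f)%N.
Proof. by elim: f => //= f1 h1 f2 h2; rewrite muln_gt0 h1. Qed.

Lemma fprec_gt0 f : (0 < fprec f)%N.
Proof. by elim: f => //= f1 h1 f2 h2; rewrite leq_max h1. Qed.

(** Equalities persist because [near] elements vanish together, divisibilities by the second half of
    [agree], and [FR] atoms by [near_rho_eq]. *)
Lemma sat_agree E M L e i x x' f :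
  (0 < M)%N -> (0 < E)%N -> (forall w, veq w 1 -> cong1 M (w ^+ E)) ->
  agree E M L e x x' -> qf f -> (fmod f %| E)%N -> (fprec f <= M)%N ->
  (forall t, List.In t (fterms f) -> List.In (form i t) L) ->
  sat (upd e i x) f <-> sat (upd e i x') f.
Proof.
move=> M0 E0 HE [Hnear Hvle].
have tnear t : List.In (form i t) L ->
    near E M (teval (upd e i x') t) (teval (upd e i x) t).
  by rewrite !teval_form; apply: Hnear.
elim: f => [t1 t2|t1 t2|n m t1 t2 t3|f IH|f1 IH1 f2 IH2|f1 IH1 f2 IH2|//|//] /=.
- move=> _ _ _ HL; have h := near_eq0 M0 (tnear _ (HL _ (or_introl erefl))).
  move: h; rewrite /= !subr_eq0 => h.
  by split=> /eqP; [rewrite -h | rewrite h] => /eqP.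
- move=> _ _ _ HL; rewrite !teval_form.
  have := Hvle _ _ (HL _ (or_introl erefl)) (HL _ (or_intror (or_introl erefl))).
  by rewrite /vle => ->.
- move=> _ nE mM HL.
  have h1 := near_rho_eq M0 HE nE mM (tnear _ (HL _ (or_introl erefl))).
  have h2 := near_rho_eq M0 HE nE mM
    (tnear _ (HL _ (or_intror (or_introl erefl)))).
  split=> h; last first.
    exact: rho_eq_trans (rho_eq_sym h1) (rho_eq_trans h h2).
  exact: rho_eq_trans h1 (rho_eq_trans h (rho_eq_sym h2)).
- by move=> h1 h2 h3 h4; rewrite IH.
- move=> /andP[q1 q2] hE; rewrite geq_max => /andP[m1 m2] HL.
  rewrite IH1 //; first rewrite IH2 //.
  - exact: dvdn_trans (dvdn_mull _ (dvdnn _)) hE.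
  - by move=> t ht; apply: HL; apply/List.in_or_app; right.
  - exact: dvdn_trans (dvdn_mulr _ (dvdnn _)) hE.
  - by move=> t ht; apply: HL; apply/List.in_or_app; left.
- move=> /andP[q1 q2] hE; rewrite geq_max => /andP[m1 m2] HL.
  rewrite IH1 //; first rewrite IH2 //.
  - exact: dvdn_trans (dvdn_mull _ (dvdnn _)) hE.
  - by move=> t ht; apply: HL; apply/List.in_or_app; right.
  - exact: dvdn_trans (dvdn_mulr _ (dvdnn _)) hE.
  - by move=> t ht; apply: HL; apply/List.in_or_app; left.
Qed.

(** The uniformity of [T] in [e] and [a] is what turns an existential quantifier into a finite
    disjunction. *)
Lemma witness_terms i f : qf f -> exists T : seq (term K), forall e a,
  sat (upd e i a) f -> exists2 t, List.In t T & sat (upd e i (teval e t)) f.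
Proof.
move=> qff; have M0 := fprec_gt0 f.
have [E1 E10 HE1] := unit_exponent (fprec f).
(* [E1] takes units into 1 + pi^M R_K, and the extra factor makes the exponent divisible by all
   moduli. *)
have E0 : (0 < E1 * fmod f)%N by rewrite muln_gt0 E10 fmod_gt0.
have HE w : veq w 1 -> cong1 (fprec f) (w ^+ (E1 * fmod f)).
  by move=> w1; rewrite exprM; apply: cong1X; apply: HE1.
have [T HT] := test_terms M0 E0 HE (List.map (form i) (fterms f)).
exists T => e a ha; have [t Tt ag] := HT e a; exists t => //.
have [|t' ht'|H _] := @sat_agree _ _ _ _ i _ _ _ M0 E0 HE ag qff _ (leqnn _).
- exact: dvdn_mull.
- exact: (List.in_map (form i)).
- exact: H.
Qed.

(** * Quantifier elimination *)

Definition ffalse : formula K := FNot (FEq (TConst 0) (TConst 0)).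

Definition bigor (s : seq (formula K)) : formula K :=
  List.fold_right (@FOr K) ffalse s.

Lemma sat_bigor (A : Type) e (F : A -> formula K) (s : seq A) :
  sat e (bigor (List.map F s)) <-> exists2 a, List.In a s & sat e (F a).
Proof.
elim: s => [|a s IH] /=; first by split=> [[]//|[]].
rewrite IH; split=> [[h|[b sb h]]|[b [<-|sb] h]].
- by exists a; [left |].
- by exists b; [right |].
- by left.
- by right; exists b.
Qed.

Lemma qf_bigor (A : Type) (F : A -> formula K) (s : seq A) :
  (forall a, qf (F a)) -> qf (bigor (List.map F s)).
Proof. by move=> qF; elim: s => //= a s ->; rewrite qF. Qed.

Lemma qe_ex i f : qf f -> exists2 g, qf g &
  forall e, sat e g <-> exists a, sat (upd e i a) f.
Proof.
move=> qff; have [T HT] := witness_terms i qff.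
exists (bigor (List.map (fun t => fsub (sub1 i t) f) T)).
  by apply: qf_bigor => t; rewrite qf_fsub.
move=> e; rewrite sat_bigor; split=> [[t _]|[a /HT[t Tt h]]].
  by rewrite sat_fsub // => /(sat_ext f (teval_sub1 e i t)) h; exists (teval e t).
by exists t => //; rewrite sat_fsub //; apply/(sat_ext f (teval_sub1 e i t)).
Qed.

Lemma quantifier_elimination f : exists2 g, qf g &
  forall e, sat e f <-> sat e g.
Proof.
elim: f => [t1 t2|t1 t2|n m t1 t2 t3|f [g qg H]|f1 [g1 q1 H1] f2 [g2 q2 H2]
  |f1 [g1 q1 H1] f2 [g2 q2 H2]|i f [g qg H]|i f [g qg H]].
- by exists (FEq t1 t2).
- by exists (FDiv t1 t2).
- by exists (FR n m t1 t2 t3).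
- by exists (FNot g) => // e /=; rewrite H.
- by exists (FAnd g1 g2) => /= [|e]; rewrite ?q1 // H1 H2.
- by exists (FOr g1 g2) => /= [|e]; rewrite ?q1 // H1 H2.
- have [h qh Hh] := qe_ex i qg; exists h => // e; rewrite Hh /=.
  by split=> -[a ha]; exists a; apply/H.
- have [//|h qh Hh] := @qe_ex i (FNot g).
  exists (FNot h) => // e /=; rewrite Hh /=; split=> [H1 [a]|H1 a].
    by case; apply/H.
  by apply/H; apply: NNPP => na; apply: H1; exists a.
Qed.

(** * Witness terms for several variables at once *)

Definition upds (e : nat -> K) k (s : seq K) i :=
  if (i < k)%N then e i else nth (e i) s (i - k).

(** Syntactic counterpart of [upds]; in both, the default of [nth] leaves variables past the end of
    the list unchanged. *)
Definition subs k (ts : seq (term K)) i :=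
  if (i < k)%N then TVar K i else nth (TVar K i) ts (i - k).

Lemma teval_subs e k ts :
  (fun i => teval e (subs k ts i)) =1 upds e k (map (teval e) ts).
Proof.
move=> i; rewrite /subs /upds; case: ifP => //= _.
elim: ts (i - k)%N => [|t ts IH] [|j] //=.
Qed.

Lemma upds_cons e k a s : upds e k (a :: s) =1 upds (upd e k a) k.+1 s.
Proof.
move=> i; rewrite /upds /upd ltnS; case: ltngtP => //= [ki|->].
  by rewrite subnS; case: (i - k)%N (subn_gt0 k i) => //; rewrite ki.
by rewrite subnn.
Qed.

(** Induction on r. The tuples for the later variables may mention variable k; the disjunction over
    them is quantifier-free, so [witness_terms] supplies terms for variable k, which are then
    substituted into the tuples. *)
Lemma skolem_terms r k f : qf f -> exists2 TT : seq (seq (term K)),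
  (forall ts, List.In ts TT -> size ts = r) &
  forall e s, size s = r -> sat (upds e k s) f ->
    exists2 ts, List.In ts TT & sat (upds e k (map (teval e) ts)) f.
Proof.
move=> qff; elim: r k => [|r IH] k.
  exists [:: [::]] => [ts [<-|//]//|e s /size0nil -> h].
  by exists [::] => //; left.
have [TT sTT HTT] := IH k.+1.
have satP e ts : sat e (fsub (subs k.+1 ts) f) <->
    sat (upds e k.+1 (map (teval e) ts)) f.
  by rewrite sat_fsub //; apply: sat_ext; apply: teval_subs.
have [|T HT] := @witness_terms k
    (bigor (List.map (fun ts => fsub (subs k.+1 ts) f) TT)).
  by apply: qf_bigor => ts; rewrite qf_fsub.
exists (List.flat_map (fun t => List.map (fun ts =>
  t :: map (tsub (sub1 k t)) ts) TT) T).
  move=> ts /List.in_flat_map[t [_ /List.in_map_iff[us [<- /sTT]]]] /=.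
  by rewrite size_map => ->.
move=> e [//|a s] [ss] /(sat_ext f (upds_cons e k a s)) /(HTT _ _ ss)[ts TTts h].
have [|t Tt] := HT e a; first by apply/sat_bigor; exists ts => //; apply/satP.
(* Replacing [a] by the value of [t] may change which tuple succeeds, hence a new [us]. *)
move=> /sat_bigor[us TTus /satP h'].
exists (t :: map (tsub (sub1 k t)) us).
  exact: (In_pairs (fun t ts => t :: map (tsub (sub1 k t)) ts)).
rewrite map_cons -map_comp; apply/(sat_ext f (upds_cons _ _ _ _)).
rewrite (@eq_map _ _ _ (teval (upd e k (teval e t)))) // => u /=.
by rewrite teval_tsub; apply: teval_ext; apply: teval_sub1.
Qed.

(** * The first successful tuple as a definable choice *)

Section Choice.

Variables (k r : nat) (f : formula K).
Hypothesis qff : qf f.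

Definition point (y : k.-tuple K) ts : nat -> K :=
  upds (tenv y) k (map (teval (tenv y)) ts).

Definition point_tuple y ts : (k + r).-tuple K :=
  [tuple point y ts i | i < k + r].

(* In [tenv y] the variables from [k] on are 0, whereas in the environment of a
   point of the graph they hold the remaining coordinates. *)
Definition restrict i : term K := if (i < k)%N then TVar K i else TConst 0.

Definition point_terms ts i : term K :=
  if (i < k)%N then TVar K i
  else nth (TConst 0) (map (tsub restrict) ts) (i - k).

Lemma tenv_ge n (x : n.-tuple K) i : (n <= i)%N -> tenv x i = 0.
Proof. by move=> ni; rewrite /tenv nth_default ?size_tuple. Qed.

Lemma teval_point_terms e y ts : (forall i, (i < k)%N -> e i = tenv y i) ->
  (fun i => teval e (point_terms ts i)) =1 point y ts.
Proof.
move=> ey i; rewrite /point_terms /point /upds; case: ltnP => [ik|ki] /=.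
  exact: ey.
rewrite tenv_ge //; elim: ts (i - k)%N => [|t ts IH] [|j] //=.
rewrite teval_tsub; apply: teval_ext => l; rewrite /restrict.
by case: ltnP => [/ey//|kl] /=; rewrite tenv_ge.
Qed.

(** From index k + r on both sides are 0: a list of exactly r terms is exhausted there, and [tenv y]
    vanishes. *)
Lemma tenv_point_tuple y ts : size ts = r -> tenv (point_tuple y ts) =1 point y ts.
Proof.
move=> sts i; have [ir|ri] := ltnP i (k + r).
  by rewrite /tenv -(tnth_nth _ _ (Ordinal ir)) tnth_mktuple.
rewrite tenv_ge // /point /upds ltnNge (leq_trans (leq_addr r k) ri) /=.
rewrite nth_default ?tenv_ge ?(leq_trans (leq_addr r k) ri) //.
by rewrite size_map sts leq_subRL // (leq_trans (leq_addr r k) ri).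
Qed.

Lemma proj_point_tuple y ts : proj_k (point_tuple y ts) = y.
Proof.
apply: eq_from_tnth => i; rewrite !tnth_mktuple /= /point /upds ltn_ord.
by rewrite /tenv -tnth_nth.
Qed.

(** Satisfaction is a mere proposition, hence the informative excluded middle. The final value is a
    default, reached only if no tuple works. *)
Fixpoint first_witness (TT : seq (seq (term K))) y : (k + r).-tuple K :=
  if TT is ts :: TT' then
    if excluded_middle_informative (sat (point y ts) f)
    then point_tuple y ts else first_witness TT' y
  else point_tuple y [::].

Lemma first_witness_correct TT y :
  (exists2 ts, List.In ts TT & sat (point y ts) f) ->
  exists ts, [/\ List.In ts TT, sat (point y ts) f
                & first_witness TT y = point_tuple y ts].
Proof.
elim: TT => [|ts TT IH] /=; first by case.
case: excluded_middle_informative => h; first by exists ts; split=> //; left.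
case=> us [<- //|TTus] h'; have [|vs [TTvs hvs ->]] := IH; first by exists us.
by exists vs; split=> //; right.
Qed.

Definition graph_eq ts : formula K :=
  List.fold_right (fun i => FAnd (FEq (TVar K (k + i)) (point_terms ts i)))
    (FNot ffalse) (List.seq 0 (k + r)).

(** Mirrors the branching of [first_witness]: the negated guards single out the first tuple that
    works. *)
Fixpoint graph_formula TT : formula K :=
  if TT is ts :: TT' then
    let g := fsub (point_terms ts) f in
    FOr (FAnd g (graph_eq ts)) (FAnd (FNot g) (graph_formula TT'))
  else ffalse.

Lemma tenv_fst_part (z : (k + (k + r)).-tuple K) i : (i < k)%N ->
  tenv z i = tenv (fst_part z) i.
Proof.
move=> ik; rewrite {2}/tenv -(tnth_nth _ _ (Ordinal ik)) tnth_mktuple.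
by rewrite (tnth_nth 0).
Qed.

Lemma sat_graph_eq (z : (k + (k + r)).-tuple K) ts :
  sat (tenv z) (graph_eq ts) <-> snd_part z = point_tuple (fst_part z) ts.
Proof.
have E i := teval_point_terms ts (@tenv_fst_part z) i.
have -> : sat (tenv z) (graph_eq ts) <->
    forall i, List.In i (List.seq 0 (k + r)) ->
      tenv z (k + i) = point (fst_part z) ts i.
  rewrite /graph_eq; elim: (List.seq _ _) => [|i s IH] /=.
    by split=> // _; apply.
  rewrite IH E; split=> [[h1 h2] j [<-//|/h2]//|h].
  by split=> [|j sj]; apply: h; [left | right].
have Hin i : List.In i (List.seq 0 (k + r)) <-> (i < k + r)%N.
  rewrite List.in_seq /=; split=> [[_ /ltP]//|h]; split; last exact/ltP.
  exact/leP.
have Hz (i : 'I_(k + r)) : tenv z (k + i) = tnth (snd_part z) i.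
  by rewrite tnth_mktuple (tnth_nth 0).
split=> [h|h i /Hin ir].
  apply: eq_from_tnth => i; rewrite -Hz tnth_mktuple; apply: h.
  by apply/Hin.
by rewrite (Hz (Ordinal ir)) h tnth_mktuple.
Qed.

Lemma sat_graph_formula (z : (k + (k + r)).-tuple K) TT :
  sat (tenv z) (graph_formula TT) <->
  (exists2 ts, List.In ts TT & sat (point (fst_part z) ts) f) /\
  snd_part z = first_witness TT (fst_part z).
Proof.
have E ts : sat (tenv z) (fsub (point_terms ts) f) <->
    sat (point (fst_part z) ts) f.
  rewrite sat_fsub //; apply: sat_ext; apply: teval_point_terms.
  exact: tenv_fst_part.
elim: TT => [|ts TT IH] /=; first by split=> [[]//|[[]]].
rewrite E sat_graph_eq IH; case: excluded_middle_informative => h.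
  split=> [[[_ ->]|[]]//|[_ ->]]; last by left.
  by split=> //; exists ts => //; left.
split=> [[[]//|[_ [[us TTus hus] Ez]]]|[[us [<-//|TTus] hus] Ez]].
  by split=> //; exists us => //; right.
by right; split=> //; split=> //; exists us.
Qed.

Lemma tenv_proj_k (x : (k + r).-tuple K) :
  tenv x =1 upds (tenv (proj_k x)) k (drop k x).
Proof.
move=> i; rewrite /upds; case: ltnP => [ik|ki].
  rewrite {2}/tenv -(tnth_nth _ _ (Ordinal ik)) tnth_mktuple.
  by rewrite (tnth_nth 0).
by rewrite nth_drop subnKC // (tenv_ge (proj_k x) ki).
Qed.

End Choice.

End ValuedField.

Theorem mainTheorem11 (q : nat) (K : fieldType) (G : zmodType) (le : rel G)
  (ord : K -> option G) (HK : FqZField le ord q)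
  (pi : K) (Hpi : uniformizer le ord pi)
  (k r : nat) (X : (k + r).-tuple K -> Prop)
  (HX : definable le ord pi X) :
  exists g : k.-tuple K -> (k + r).-tuple K,
    definable le ord pi (graph_on X g) /\
    (forall y : k.-tuple K, proj_set X y -> X (g y) /\ proj_k (g y) = y).
Proof.
case: HX => f0 Hf0; have [f qff Hf] := quantifier_elimination HK Hpi f0.
have [TT sTT HTT] := skolem_terms HK Hpi r k qff.
have XP y ts : List.In ts TT ->
    X (point_tuple r y ts) <-> sat le ord pi (point y ts) f.
  move=> /sTT sts; rewrite Hf0 Hf; apply: sat_ext.
  exact: tenv_point_tuple.
(* A nonempty fibre contains a point whose last r coordinates are values of a tuple in [TT], so the
   projection is a finite disjunction over [TT]. *)
have projP y : proj_set X y <->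
    exists2 ts, List.In ts TT & sat le ord pi (point y ts) f.
  split=> [[x [Xx <-]]|[ts TTts h]]; last first.
    exists (point_tuple r y ts); split; last exact: proj_point_tuple.
    exact/XP.
  apply: HTT (drop k x) _ _; first by rewrite size_drop size_tuple addKn.
  apply/(sat_ext _ _ _ _ (tenv_proj_k x)); apply/Hf; exact/Hf0.
exists (first_witness le ord pi r f TT); split.
  exists (graph_formula k r f TT) => z.
  by rewrite sat_graph_formula // /graph_on projP.
move=> y /projP /(first_witness_correct r)[ts [TTts h ->]].
by split; [apply/XP | apply: proj_point_tuple].
Qed.
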